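(* Let $x:S\to\mathbb{R}^3_1$ be a space-like constant slope surface immersed in $\mathbb{R}^3_1$ which lies in the time-like cone, parametrized by $$x(u,v)=u\sinh\theta\,\big(\cosh\xi_2(u)\,g(v)+\sinh\xi_2(u)\,g(v)\times g'(v)\big),$$ where $\theta$ is a constant different from $0$, $\xi_2(u)=\coth\theta\,\ln u$ and $g$ is a unit speed space-like curve on $\mathbb{H}^2$. If $x(v)$ is a $v$-parameter curve of the surface $x(u,v)$ (that is, $x(v)=x(u,v)$ with $u$ constant), then $\int_0^v x(v)\,dv$ is a time-like Bertrand curve.
   Context: Minkowski 3-space $\mathbb{R}^3_1$ is $\mathbb{R}^3$ with $\langle x,y\rangle=x_1y_1+x_2y_2-x_3y_3$ and $\|x\|=\sqrt{|\langle x,x\rangle|}$. A vector $x$ is space-like if $\langle x,x\rangle>0$ or $x=0$, time-like if $\langle x,x\rangle<0$, light-like if $\langle x,x\rangle=0$ and $x\neq0$. A regular curve is space-like (time-like) if all its velocity vectors are; it is unit speed if its velocity has pseudo-norm $1$. The Lorentzian cross product is $x\times y=(x_2y_3-x_3y_2,\;x_3y_1-x_1y_3,\;x_2y_1-x_1y_2)$, so that $\langle x\times y,z\rangle=\det(x,y,z)$. Hyperbolic space is $\mathbb{H}^2=\{x\in\mathbb{R}^3_1:\langle x,x\rangle=-1\}$. A space-like constant slope surface is a space-like surface whose position vector makes a constant angle with the normal at each point. By a known classification (Fu and Yang), the space-like constant slope surfaces lying in the time-like cone (the region where position vectors are time-like) are exactly those that can be parametrized in the form given in the claim. For a time-like curve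 $\alpha$ with arc-length parameter $s$, the Frenet frame is $T=\alpha'$, $N=\alpha''/\|\alpha''\|$, $B=T\times N$; the curvature is $\kappa=\|T'\|$ and the torsion is $\tau=\langle N',B\rangle$. A time-like curve is a (time-like) Bertrand curve if and only if there are non-zero real constants $A,B$ such that $A\kappa(s)+B\tau(s)=1$ for all $s$.
   Formalization: The v-parameter curve u = 1 is excluded: there ξ₂ = 0, the integral curve has constant curvature and torsion proportional to the geodesic curvature of g, so for non-constant geodesic curvature no non-zero A, B with Aκ + Bτ = 1 exist. *)

(* Defs.v *)
From Stdlib Require Import Reals.
From Coquelicot Require Import Coquelicot.
Open Scope R_scope.

Record vec := Vec { c1 : R; c2 : R; c3 : R }.

Definition vzero : vec := Vec 0 0 0.
Definition vadd (x y : vec) : vec := Vec (c1 x + c1 y) (c2 x + c2 y) (c3 x + c3 y).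
Definition vscal (k : R) (x : vec) : vec := Vec (k * c1 x) (k * c2 x) (k * c3 x).

Definition mink (x y : vec) : R := c1 x * c1 y + c2 x * c2 y - c3 x * c3 y.
Definition pnorm (x : vec) : R := sqrt (Rabs (mink x x)).

(* The sign of the third coordinate makes mink (cross x y) z = det (x, y, z). *)
Definition cross (x y : vec) : vec :=
  Vec (c2 x * c3 y - c3 x * c2 y)
      (c3 x * c1 y - c1 x * c3 y)
      (c2 x * c1 y - c1 x * c2 y).

Definition spacelike (x : vec) : Prop := 0 < mink x x \/ x = vzero.
Definition timelike (x : vec) : Prop := mink x x < 0.

Definition in_H2 (x : vec) : Prop := mink x x = -1.

Definition vDerive (f : R -> vec) (t : R) : vec :=
  Vec (Derive (fun r => c1 (f r)) t)
      (Derive (fun r => c2 (f r)) t)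
      (Derive (fun r => c3 (f r)) t).

Definition vRInt (f : R -> vec) (p q : R) : vec :=
  Vec (RInt (fun r => c1 (f r)) p q)
      (RInt (fun r => c2 (f r)) p q)
      (RInt (fun r => c3 (f r)) p q).

Definition in_itv (a b : Rbar) (t : R) : Prop := Rbar_lt a t /\ Rbar_lt t b.

(* Curves are total functions; only their values on an open interval ]a, b[,
   possibly unbounded, are meaningful. *)
Definition smooth_on (a b : Rbar) (f : R -> vec) : Prop :=
  forall (n : nat) (t : R), in_itv a b t ->
    ex_derive_n (fun r => c1 (f r)) n t /\
    ex_derive_n (fun r => c2 (f r)) n t /\
    ex_derive_n (fun r => c3 (f r)) n t.

Definition regular_curve (a b : Rbar) (f : R -> vec) : Prop :=
  smooth_on a b f /\ forall t, in_itv a b t -> vDerive f t <> vzero.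

Definition spacelike_curve (a b : Rbar) (f : R -> vec) : Prop :=
  regular_curve a b f /\ forall t, in_itv a b t -> spacelike (vDerive f t).

Definition timelike_curve (a b : Rbar) (f : R -> vec) : Prop :=
  regular_curve a b f /\ forall t, in_itv a b t -> timelike (vDerive f t).

Definition unit_speed (a b : Rbar) (f : R -> vec) : Prop :=
  forall t, in_itv a b t -> pnorm (vDerive f t) = 1.

(* Frenet apparatus of a unit speed time-like curve. *)
Definition fT (f : R -> vec) (s : R) : vec := vDerive f s.
Definition fN (f : R -> vec) (s : R) : vec :=
  vscal (/ pnorm (vDerive (vDerive f) s)) (vDerive (vDerive f) s).
Definition fB (f : R -> vec) (s : R) : vec := cross (fT f s) (fN f s).
Definition curvature (f : R -> vec) (s : R) : R := pnorm (vDerive (fT f) s).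
Definition torsion (f : R -> vec) (s : R) : R := mink (vDerive (fN f) s) (fB f s).

(* h is the curve f expressed in its arc-length parameter s = phi t. *)
Definition arclength_reparam (a b : Rbar) (f : R -> vec)
    (a' b' : Rbar) (h : R -> vec) : Prop :=
  exists phi : R -> R,
    (forall t, in_itv a b t ->
       in_itv a' b' (phi t) /\
       is_derive phi t (pnorm (vDerive f t)) /\
       h (phi t) = f t) /\
    (forall s, in_itv a' b' s -> exists t, in_itv a b t /\ phi t = s).

(* The curvature is required not to vanish, so that the Frenet frame, hence the
   torsion, is defined everywhere. *)
Definition timelike_bertrand (a b : Rbar) (f : R -> vec) : Prop :=
  timelike_curve a b f /\
  exists (a' b' : Rbar) (h : R -> vec),
    arclength_reparam a b f a' b' h /\
    timelike_curve a' b' h /\ unit_speed a' b' h /\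
    (forall s, in_itv a' b' s -> 0 < curvature h s) /\
    exists A B : R, A <> 0 /\ B <> 0 /\
      forall s, in_itv a' b' s -> A * curvature h s + B * torsion h s = 1.

Definition d_u (x : R -> R -> vec) (u v : R) : vec := vDerive (fun r => x r v) u.
Definition d_v (x : R -> R -> vec) (u v : R) : vec := vDerive (fun r => x u r) v.

Definition immersion (D : R * R -> Prop) (x : R -> R -> vec) : Prop :=
  forall u v, D (u, v) -> forall p q : R,
    vadd (vscal p (d_u x u v)) (vscal q (d_v x u v)) = vzero -> p = 0 /\ q = 0.

Definition spacelike_surface (D : R * R -> Prop) (x : R -> R -> vec) : Prop :=
  immersion D x /\
  forall u v, D (u, v) -> forall p q : R,
    spacelike (vadd (vscal p (d_u x u v)) (vscal q (d_v x u v))).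

Definition in_timelike_cone (D : R * R -> Prop) (x : R -> R -> vec) : Prop :=
  forall u v, D (u, v) -> timelike (x u v).

Definition normal_at (x : R -> R -> vec) (u v : R) (n : vec) : Prop :=
  n <> vzero /\ mink n (d_u x u v) = 0 /\ mink n (d_v x u v) = 0.

(* For a space-like surface in the time-like cone, the position vector and the
   normal are both time-like, and their angle w is the hyperbolic one.  The
   absolute value makes it independent of the time-orientation of n. *)
Definition constant_slope (D : R * R -> Prop) (x : R -> R -> vec) : Prop :=
  exists w : R, 0 <= w /\
    forall u v, D (u, v) -> forall n, normal_at x u v n ->
      Rabs (mink (x u v) n) = pnorm (x u v) * pnorm n * cosh w.

Definition coth (t : R) : R := cosh t / sinh t.

Definition xi2 (theta u : R) : R := coth theta * ln u.

(* Main.v *)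
From Stdlib Require Import Reals Ranalysis5 Lra Lia.
From Coquelicot Require Import Coquelicot.
Require Import Defs.
Open Scope R_scope.

(** Write [n = g x g'] for the unit conormal of the curve [g] of the hyperbolic
    plane and [k = <g'', n>] for its geodesic curvature.  Then [(g, g', n)] is a
    Lorentz-orthonormal frame with
      [g'' = g + k n]  and  [n' = - k g'].
    Put [c = cosh (xi2 u)], [s = sinh (xi2 u)] and [m = u sinh theta].  A
    [v]-parameter curve is [m p], where [p = c g + s n] is the equidistant curve
    of [g] at signed distance [xi2 u]; it lies on the hyperbolic plane again and
    satisfies [p' = (c - s k) g'] ([is_vderive_equidistant]).

    Hence the primitive of [m p] has constant squared speed [- m^2], so it is
    time-like and its arc length is [|m| v].  Its Frenet frame is, up to signs,
    [p], [g'], [s g + c n], and differentiating it gives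
      [kappa = |c - s k| / |m|]  and  [tau = (c k - s) / m].
    The immersion hypothesis on the surface says that [m p'] does not vanish,
    that is [c - s k <> 0]; by continuity this quantity has a constant sign
    [e].  Since [c (c - s k) + s (c k - s) = c^2 - s^2 = 1], the constants
    [A = e |m| c] and [B = m s] satisfy [A kappa + B tau = 1]
    ([bertrand_of_velocity]).  They are nonzero because [c >= 1] and because
    [u <> 1] gives [xi2 u <> 0]. *)

(** * Open intervals *)

Lemma in_itv_locally (a b : Rbar) (t : R) :
  in_itv a b t -> locally t (in_itv a b).
Proof.
  intros [H1 H2]. apply filter_and.
  - exact (open_Rbar_gt a t H1).
  - exact (open_Rbar_lt b t H2).
Qed.

Lemma in_itv_convex (a b : Rbar) (p q t : R) :
  in_itv a b p -> in_itv a b q -> p <= t <= q -> in_itv a b t.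
Proof.
  intros [H1 _] [_ H2] [H3 H4]. split.
  - apply Rbar_lt_le_trans with p; auto.
  - apply Rbar_le_lt_trans with q; auto.
Qed.

Lemma in_itv_scal (a b : Rbar) (r : posreal) (t : R) :
  in_itv (Rbar_mult_pos a r) (Rbar_mult_pos b r) (t * r) <-> in_itv a b t.
Proof.
  unfold in_itv.
  rewrite (Rbar_mult_pos_lt a t r), (Rbar_mult_pos_lt t b r). reflexivity.
Qed.

(** The sign is returned as a factor [e = 1] or [e = -1], so that [|q| = e q]
    with one constant [e] for the whole interval. *)
Lemma nonvanishing_constant_sign (a b : Rbar) (q : R -> R) :
  (forall t, in_itv a b t -> continuous q t) ->
  (forall t, in_itv a b t -> q t <> 0) ->
  exists e, e * e = 1 /\ forall t, in_itv a b t -> 0 < e * q t.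
Proof.
  intros Hc Hn.
  (* the interval may be empty *)
  destruct (Classical_Prop.classic (exists t0, in_itv a b t0)) as [[t0 H0]|H].
  2:{ exists 1. split; [lra|]. intros t Ht. elim H. now exists t. }
  assert (Hopp : forall e p t, (e = 1 \/ e = -1) -> in_itv a b p ->
            in_itv a b t -> p < t -> e * q p < 0 -> 0 < e * q t -> False).
  { intros e p t He Hp Ht Hpt Hqp Hqt.
    destruct (IVT_interv (fun r => e * q r) p t) as [z [Hz Hqz]]; auto.
    - intros r Hr. apply continuity_pt_filterlim.
      apply (continuous_scal_r e q). apply Hc.
      now apply in_itv_convex with p t.
    - apply (Hn z). { now apply in_itv_convex with p t. }
      destruct He as [-> | ->]; lra. }
  assert (Hone : forall e, (e = 1 \/ e = -1) -> 0 < e * q t0 ->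
            forall t, in_itv a b t -> 0 < e * q t).
  { intros e He H t Ht.
    destruct (Rlt_or_le 0 (e * q t)) as [Hp|Hp]; auto.
    assert (Hneg : e * q t < 0).
    { specialize (Hn t Ht). destruct He as [-> | ->]; lra. }
    exfalso. destruct (Rtotal_order t0 t) as [Hlt|[Heq|Hlt]].
    - apply (Hopp (- e) t0 t); auto; try lra.
    - subst t0. lra.
    - apply (Hopp e t t0); auto. }
  destruct (Rtotal_order 0 (q t0)) as [Hlt|[Heq|Hlt]].
  - exists 1. split; [lra|]. apply Hone; auto; lra.
  - exfalso. apply (Hn t0); auto.
  - exists (-1). split; [lra|]. apply Hone; auto; lra.
Qed.

(** * Smooth functions on an open interval *)

Definition smooth_fun (a b : Rbar) (f : R -> R) : Prop :=
  forall n t, in_itv a b t -> ex_derive_n f n t.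

Lemma Derive_n_Derive (f : R -> R) (n : nat) (t : R) :
  Derive_n (Derive f) n t = Derive_n f (S n) t.
Proof.
  change (Derive f) with (Derive_n f 1).
  rewrite Derive_n_comp. now rewrite PeanoNat.Nat.add_1_r.
Qed.

Lemma ex_derive_n_Derive (f : R -> R) (n : nat) (t : R) :
  ex_derive f t -> ex_derive_n (Derive f) n t -> ex_derive_n f (S n) t.
Proof.
  destruct n as [|n]; [auto|]. intros _.
  apply ex_derive_ext. intros r. apply Derive_n_Derive.
Qed.

Lemma smooth_fun_ex_derive (a b : Rbar) (f : R -> R) (t : R) :
  smooth_fun a b f -> in_itv a b t -> ex_derive f t.
Proof. intros Hf Ht. exact (Hf 1%nat t Ht). Qed.

Lemma smooth_fun_Derive (a b : Rbar) (f : R -> R) :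
  smooth_fun a b f -> smooth_fun a b (Derive f).
Proof.
  intros Hf [|n] t Ht; [exact I|].
  apply ex_derive_ext with (Derive_n f (S n)).
  - intros r. now rewrite Derive_n_Derive.
  - exact (Hf (S (S n)) t Ht).
Qed.

Lemma smooth_fun_ext (a b : Rbar) (f h : R -> R) :
  (forall t, in_itv a b t -> f t = h t) -> smooth_fun a b f -> smooth_fun a b h.
Proof.
  intros E Hf n t Ht. apply ex_derive_n_ext_loc with f; [|now apply Hf].
  apply filter_imp with (2 := in_itv_locally a b t Ht). exact E.
Qed.

Lemma smooth_fun_primitive (a b : Rbar) (f df : R -> R) :
  (forall t, in_itv a b t -> is_derive f t (df t)) ->
  smooth_fun a b df -> smooth_fun a b f.
Proof.
  intros Hd Hdf [|n] t Ht; [exact I|].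
  apply ex_derive_n_Derive. { exists (df t). now apply Hd. }
  revert n t Ht. apply smooth_fun_ext with df; auto.
  intros t Ht. symmetry. apply is_derive_unique. now apply Hd.
Qed.

Lemma smooth_fun_plus (a b : Rbar) (f h : R -> R) :
  smooth_fun a b f -> smooth_fun a b h -> smooth_fun a b (fun t => f t + h t).
Proof.
  intros Hf Hh n t Ht.
  apply ex_derive_n_plus; apply filter_imp with (2 := in_itv_locally a b t Ht);
    intros r Hr j _; auto.
Qed.

Lemma smooth_fun_scal (a b : Rbar) (k : R) (f : R -> R) :
  smooth_fun a b f -> smooth_fun a b (fun t => k * f t).
Proof. intros Hf n t Ht. apply ex_derive_n_scal_l. now apply Hf. Qed.

(** Leibniz's rule writes the derivative of [f h] with the products [f' h] and
    [f h'], so the induction on the order has to range over all pairs of smooth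
    functions. *)
Lemma smooth_fun_mult (a b : Rbar) (f h : R -> R) :
  smooth_fun a b f -> smooth_fun a b h -> smooth_fun a b (fun t => f t * h t).
Proof.
  intros Hf Hh n. revert f h Hf Hh.
  induction n as [n IH] using (well_founded_induction Wf_nat.lt_wf).
  intros f h Hf Hh t Ht. destruct n as [|n]; [exact I|].
  assert (Hd : forall r, in_itv a b r ->
            is_derive (fun t => f t * h t) r (Derive f r * h r + f r * Derive h r)).
  { intros r Hr.
    apply Derive.is_derive_mult; apply Derive_correct;
      now apply smooth_fun_ex_derive with a b. }
  apply ex_derive_n_Derive. { eexists. now apply Hd. }
  apply ex_derive_n_ext_loc with (fun r => Derive f r * h r + f r * Derive h r).
  - apply filter_imp with (2 := in_itv_locally a b t Ht).
    intros r Hr. symmetry. apply is_derive_unique. now apply Hd.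
  - apply ex_derive_n_plus; apply filter_imp with (2 := in_itv_locally a b t Ht);
      intros r Hr j Hj; apply IH; auto using smooth_fun_Derive; lia.
Qed.

Lemma smooth_on_components (a b : Rbar) (F : R -> vec) :
  smooth_on a b F <->
  smooth_fun a b (fun r => c1 (F r)) /\ smooth_fun a b (fun r => c2 (F r)) /\
  smooth_fun a b (fun r => c3 (F r)).
Proof.
  split.
  - intros H. repeat split; intros n t Ht; apply (H n t Ht).
  - intros (H1 & H2 & H3) n t Ht. repeat split; auto.
Qed.

Lemma smooth_on_ext (a b : Rbar) (F G : R -> vec) :
  (forall t, in_itv a b t -> F t = G t) -> smooth_on a b F -> smooth_on a b G.
Proof.
  rewrite !smooth_on_components. intros E (H1 & H2 & H3). repeat apply conj.
  - apply (smooth_fun_ext a b _ _) with (2 := H1). intros t Ht. now rewrite E.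
  - apply (smooth_fun_ext a b _ _) with (2 := H2). intros t Ht. now rewrite E.
  - apply (smooth_fun_ext a b _ _) with (2 := H3). intros t Ht. now rewrite E.
Qed.

Lemma smooth_on_vDerive (a b : Rbar) (F : R -> vec) :
  smooth_on a b F -> smooth_on a b (vDerive F).
Proof.
  rewrite !smooth_on_components. intros (H1 & H2 & H3).
  repeat split; now apply smooth_fun_Derive.
Qed.

Lemma smooth_on_add (a b : Rbar) (F G : R -> vec) :
  smooth_on a b F -> smooth_on a b G -> smooth_on a b (fun t => vadd (F t) (G t)).
Proof.
  rewrite !smooth_on_components. intros (H1 & H2 & H3) (H4 & H5 & H6).
  repeat split; simpl; now apply smooth_fun_plus.
Qed.

Lemma smooth_on_scal (a b : Rbar) (k : R) (F : R -> vec) :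
  smooth_on a b F -> smooth_on a b (fun t => vscal k (F t)).
Proof.
  rewrite !smooth_on_components. intros (H1 & H2 & H3).
  repeat split; simpl; now apply smooth_fun_scal.
Qed.

Lemma smooth_on_cross (a b : Rbar) (F G : R -> vec) :
  smooth_on a b F -> smooth_on a b G -> smooth_on a b (fun t => cross (F t) (G t)).
Proof.
  assert (Hminus : forall f1 f2 h1 h2,
    smooth_fun a b f1 -> smooth_fun a b f2 -> smooth_fun a b h1 ->
    smooth_fun a b h2 -> smooth_fun a b (fun t => f1 t * h1 t - f2 t * h2 t)).
  { intros f1 f2 h1 h2 Hf1 Hf2 Hh1 Hh2.
    apply smooth_fun_ext with (fun t => f1 t * h1 t + (-1) * (f2 t * h2 t)).
    { intros; ring. }
    apply smooth_fun_plus; [|apply smooth_fun_scal]; now apply smooth_fun_mult. }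
  rewrite !smooth_on_components. intros (H1 & H2 & H3) (H4 & H5 & H6).
  repeat split; simpl; now apply Hminus.
Qed.

Lemma smooth_on_rescale (a b : Rbar) (r : posreal) (F : R -> vec) :
  smooth_on a b F ->
  smooth_on (Rbar_mult_pos a r) (Rbar_mult_pos b r) (fun t => F (/ r * t)).
Proof.
  assert (Hr := cond_pos r).
  assert (Hfun : forall f, smooth_fun a b f ->
    smooth_fun (Rbar_mult_pos a r) (Rbar_mult_pos b r) (fun t => f (/ r * t))).
  { intros f Hf n t Ht. apply ex_derive_n_comp_scal.
    assert (Ht' : in_itv a b (/ r * t)).
    { apply in_itv_scal with r.
      replace (/ r * t * r) with t by (field; lra). exact Ht. }
    apply filter_imp with (2 := in_itv_locally a b _ Ht').
    intros y Hy j _. now apply Hf. }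
  rewrite !smooth_on_components. intros (H1 & H2 & H3).
  repeat split;
    [now apply (Hfun (fun t => c1 (F t))) | now apply (Hfun (fun t => c2 (F t)))
    | now apply (Hfun (fun t => c3 (F t)))].
Qed.

(** * Derivatives of curves *)

Definition is_vderive (F : R -> vec) (t : R) (l : vec) : Prop :=
  is_derive (fun r => c1 (F r)) t (c1 l) /\
  is_derive (fun r => c2 (F r)) t (c2 l) /\
  is_derive (fun r => c3 (F r)) t (c3 l).

Lemma vec_eq (x y : vec) : c1 x = c1 y -> c2 x = c2 y -> c3 x = c3 y -> x = y.
Proof. destruct x, y; simpl; congruence. Qed.

Ltac vec_ring :=
  repeat match goal with v : vec |- _ => destruct v end;
  unfold vadd, vscal, cross, mink, vzero; simpl;
  try (apply vec_eq; simpl); ring.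

Lemma is_vderive_unique (F : R -> vec) (t : R) (l : vec) :
  is_vderive F t l -> vDerive F t = l.
Proof. intros (H1 & H2 & H3). apply vec_eq; now apply is_derive_unique. Qed.

Lemma is_vderive_ext_itv (a b : Rbar) (F G : R -> vec) (t : R) (l : vec) :
  (forall r, in_itv a b r -> F r = G r) -> in_itv a b t ->
  is_vderive F t l -> is_vderive G t l.
Proof.
  intros E Ht (H1 & H2 & H3).
  split; [|split];
    (eapply is_derive_ext_loc; [|eassumption]);
    apply filter_imp with (2 := in_itv_locally a b t Ht);
    intros r Hr; now rewrite (E r Hr).
Qed.

Lemma smooth_on_is_vderive (a b : Rbar) (F : R -> vec) (t : R) :
  smooth_on a b F -> in_itv a b t -> is_vderive F t (vDerive F t).
Proof.
  intros HF Ht. destruct (HF 1%nat t Ht) as (H1 & H2 & H3).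
  split; [|split]; now apply Derive_correct.
Qed.

Lemma smooth_on_primitive (a b : Rbar) (F dF : R -> vec) :
  (forall t, in_itv a b t -> is_vderive F t (dF t)) ->
  smooth_on a b dF -> smooth_on a b F.
Proof.
  rewrite !smooth_on_components. intros Hd (H1 & H2 & H3).
  repeat split;
    [apply (smooth_fun_primitive a b _ _) with (2 := H1)
    |apply (smooth_fun_primitive a b _ _) with (2 := H2)
    |apply (smooth_fun_primitive a b _ _) with (2 := H3)];
    intros t Ht; apply (Hd t Ht).
Qed.

Lemma is_vderive_add (F G : R -> vec) (t : R) (l k : vec) :
  is_vderive F t l -> is_vderive G t k ->
  is_vderive (fun r => vadd (F r) (G r)) t (vadd l k).
Proof.
  assert (Hplus : forall f h d e, is_derive f t d -> is_derive h t e ->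
    is_derive (fun r => f r + h r) t (d + e))
    by (intros f h d e; apply (is_derive_plus f h)).
  intros (H1 & H2 & H3) (H4 & H5 & H6).
  split; [|split]; simpl; now apply Hplus.
Qed.

Lemma is_vderive_scal (k : R) (F : R -> vec) (t : R) (l : vec) :
  is_vderive F t l -> is_vderive (fun r => vscal k (F r)) t (vscal k l).
Proof.
  intros (H1 & H2 & H3). split; [|split]; now apply is_derive_scal.
Qed.

Lemma is_vderive_cross (F G : R -> vec) (t : R) (l k : vec) :
  is_vderive F t l -> is_vderive G t k ->
  is_vderive (fun r => cross (F r) (G r)) t (vadd (cross l (G t)) (cross (F t) k)).
Proof.
  assert (Hdet : forall f1 f2 h1 h2 d1 d2 e1 e2, is_derive f1 t d1 ->
    is_derive f2 t d2 -> is_derive h1 t e1 -> is_derive h2 t e2 ->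
    is_derive (fun r => f1 r * h1 r - f2 r * h2 r) t
      (d1 * h1 t - d2 * h2 t + (f1 t * e1 - f2 t * e2))).
  { intros f1 f2 h1 h2 d1 d2 e1 e2 Hf1 Hf2 Hh1 Hh2.
    replace (d1 * h1 t - d2 * h2 t + (f1 t * e1 - f2 t * e2))
      with ((d1 * h1 t + f1 t * e1) - (d2 * h2 t + f2 t * e2)) by ring.
    apply (is_derive_minus (fun r => f1 r * h1 r) (fun r => f2 r * h2 r));
      now apply Derive.is_derive_mult. }
  intros (H1 & H2 & H3) (H4 & H5 & H6).
  split; [|split]; simpl; now apply Hdet.
Qed.

Lemma is_derive_mink (F G : R -> vec) (t : R) (l k : vec) :
  is_vderive F t l -> is_vderive G t k ->
  is_derive (fun r => mink (F r) (G r)) t (mink l (G t) + mink (F t) k).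
Proof.
  intros (H1 & H2 & H3) (H4 & H5 & H6). unfold mink.
  match goal with |- is_derive _ _ ?d =>
    replace d with
      ((c1 l * c1 (G t) + c1 (F t) * c1 k) + (c2 l * c2 (G t) + c2 (F t) * c2 k)
       - (c3 l * c3 (G t) + c3 (F t) * c3 k)) by ring end.
  apply (is_derive_minus (fun r => c1 (F r) * c1 (G r) + c2 (F r) * c2 (G r))
           (fun r => c3 (F r) * c3 (G r)));
    [apply (is_derive_plus (fun r => c1 (F r) * c1 (G r))
              (fun r => c2 (F r) * c2 (G r)))|];
    now apply Derive.is_derive_mult.
Qed.

Lemma is_vderive_rescale (k : R) (F : R -> vec) (t : R) (l : vec) :
  is_vderive F (k * t) l -> is_vderive (fun r => F (k * r)) t (vscal k l).
Proof.
  assert (Hk : is_derive (fun r => k * r) t k).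
  { assert (H := is_derive_scal (fun r => r) t k 1 (is_derive_id t)).
    now rewrite Rmult_1_r in H. }
  intros (H1 & H2 & H3).
  split; [|split]; simpl;
    [exact (is_derive_comp (fun y => c1 (F y)) _ _ _ _ H1 Hk)
    |exact (is_derive_comp (fun y => c2 (F y)) _ _ _ _ H2 Hk)
    |exact (is_derive_comp (fun y => c3 (F y)) _ _ _ _ H3 Hk)].
Qed.

Lemma is_vderive_vRInt (a b : Rbar) (F : R -> vec) (p t : R) :
  smooth_on a b F -> in_itv a b p -> in_itv a b t ->
  is_vderive (vRInt F p) t (F t).
Proof.
  assert (Hfun : forall f, smooth_fun a b f -> in_itv a b p -> in_itv a b t ->
    is_derive (fun r => RInt f p r) t (f t)).
  { intros f Hf Hp Ht.
    assert (Hc : forall r, in_itv a b r -> continuous f r).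
    { intros r Hr. apply @ex_derive_continuous.
      now apply smooth_fun_ex_derive with a b. }
    apply @is_derive_RInt with p; [|now apply Hc].
    apply filter_imp with (2 := in_itv_locally a b t Ht).
    intros r Hr. apply @RInt_correct. apply @ex_RInt_continuous.
    intros z Hz. apply Hc.
    apply in_itv_convex with (Rmin p r) (Rmax p r); auto.
    - now apply Rmin_case.
    - now apply Rmax_case. }
  rewrite smooth_on_components. intros (H1 & H2 & H3) Hp Ht.
  split; [|split];
    [now apply (Hfun (fun r => c1 (F r))) | now apply (Hfun (fun r => c2 (F r)))
    | now apply (Hfun (fun r => c3 (F r)))].
Qed.

(** * Lorentzian algebra *)

Lemma mink_comm (x y : vec) : mink x y = mink y x.
Proof. vec_ring. Qed.

Lemma mink_add_l (x y z : vec) : mink (vadd x y) z = mink x z + mink y z.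
Proof. vec_ring. Qed.

Lemma mink_add_r (x y z : vec) : mink z (vadd x y) = mink z x + mink z y.
Proof. vec_ring. Qed.

Lemma mink_scal_l (k : R) (x y : vec) : mink (vscal k x) y = k * mink x y.
Proof. vec_ring. Qed.

Lemma mink_scal_r (k : R) (x y : vec) : mink x (vscal k y) = k * mink x y.
Proof. vec_ring. Qed.

Lemma mink_cross_cross (x y : vec) :
  mink (cross x y) (cross x y) = mink x y * mink x y - mink x x * mink y y.
Proof. vec_ring. Qed.

Lemma cross_cross_l (x y z : vec) :
  cross (cross x y) z =
  vadd (vscal (mink y z) x) (vscal (- mink x z) y).
Proof. vec_ring. Qed.

Lemma cross_cross_r (x y z : vec) :
  cross x (cross y z) =
  vadd (vscal (mink x y) z) (vscal (- mink x z) y).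
Proof. vec_ring. Qed.

Lemma mink_cross_l (x y : vec) : mink x (cross x y) = 0.
Proof. vec_ring. Qed.

Lemma cross_self (x : vec) : cross x x = vzero.
Proof. vec_ring. Qed.

(** This is the expansion of [w] in the orthonormal frame [(x, y, x x y)],
    crossed with the time-like vector [x]. *)
Lemma cross_frame (x y w : vec) :
  mink x x = -1 -> mink y y = 1 -> mink x y = 0 ->
  mink x w = -1 -> mink y w = 0 ->
  cross x w = vscal (- mink w (cross x y)) y.
Proof.
  intros Hxx Hyy Hxy Hxw Hyw.
  assert (Hn : mink (cross x y) (cross x y) = 1)
    by (rewrite mink_cross_cross, Hxx, Hyy, Hxy; ring).
  (* [n x (n x w)], with [n = x x y], is computed by both double product rules *)
  assert (E : vadd (vscal 1 w) (vscal (- mink w (cross x y)) (cross x y)) = x).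
  { rewrite <- Hn, (mink_comm w), <- cross_cross_r.
    rewrite (cross_cross_l x y w), Hxw, Hyw.
    replace (vadd (vscal 0 x) (vscal (- -1) y)) with y by vec_ring.
    rewrite cross_cross_l, Hyy, Hxy. vec_ring. }
  set (k := mink w (cross x y)) in *.
  assert (Ew : w = vadd x (vscal k (cross x y))) by (rewrite <- E at 1; vec_ring).
  replace (cross x w) with (vscal k (cross x (cross x y)))
    by (rewrite Ew; generalize (cross x y); intros; vec_ring).
  rewrite cross_cross_r, Hxx, Hxy. vec_ring.
Qed.

Lemma pnorm_scal (k : R) (x : vec) : pnorm (vscal k x) = Rabs k * pnorm x.
Proof.
  unfold pnorm. rewrite mink_scal_l, mink_scal_r, !Rabs_mult, <- Rmult_assoc.
  rewrite sqrt_mult_alt by (apply Rle_0_sqr).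
  rewrite (sqrt_square (Rabs k)) by apply Rabs_pos. reflexivity.
Qed.

Lemma pnorm_1 (x : vec) : Rabs (mink x x) = 1 -> pnorm x = 1.
Proof. intros H. unfold pnorm. rewrite H. apply sqrt_1. Qed.

Lemma timelike_regular (a b : Rbar) (F : R -> vec) :
  smooth_on a b F -> (forall t, in_itv a b t -> timelike (vDerive F t)) ->
  timelike_curve a b F.
Proof.
  intros HF Ht. split; [split|]; auto.
  intros t H E. specialize (Ht t H). unfold timelike in Ht. rewrite E in Ht.
  unfold mink, vzero in Ht. simpl in Ht. lra.
Qed.

(** * Unit speed curves on the hyperbolic plane and their equidistant curves *)

Definition unit_curve_H2 (a b : Rbar) (g : R -> vec) : Prop :=
  smooth_on a b g /\
  forall v, in_itv a b v ->
    in_H2 (g v) /\ mink (vDerive g v) (vDerive g v) = 1.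

Definition conormal (g : R -> vec) (v : R) : vec := cross (g v) (vDerive g v).

Definition geodesic_curvature (g : R -> vec) (v : R) : R :=
  mink (vDerive (vDerive g) v) (conormal g v).

(** With [c = cosh d] and [s = sinh d] this is the curve at signed distance [d]
    from [g] in the hyperbolic plane. *)
Definition equidistant (c s : R) (g : R -> vec) (v : R) : vec :=
  vadd (vscal c (g v)) (vscal s (conormal g v)).

Lemma derivative_of_constant (a b : Rbar) (q : R -> R) (k t d : R) :
  (forall r, in_itv a b r -> q r = k) -> in_itv a b t -> is_derive q t d -> d = 0.
Proof.
  intros Hk Ht Hd. rewrite <- (is_derive_unique _ _ _ Hd).
  rewrite <- (Derive_const k t). apply Derive_ext_loc.
  apply filter_imp with (2 := in_itv_locally a b t Ht). exact Hk.
Qed.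

Section UnitCurve.
Context (a b : Rbar) (g : R -> vec) (Hg : unit_curve_H2 a b g).

Lemma unit_curve_is_vderive (v : R) :
  in_itv a b v -> is_vderive g v (vDerive g v).
Proof. apply smooth_on_is_vderive, Hg. Qed.

Lemma unit_curve_is_vderive2 (v : R) :
  in_itv a b v -> is_vderive (vDerive g) v (vDerive (vDerive g) v).
Proof. apply smooth_on_is_vderive, smooth_on_vDerive, Hg. Qed.

Lemma mink_g_g' (v : R) : in_itv a b v -> mink (g v) (vDerive g v) = 0.
Proof.
  intros Hv. assert (Hd := unit_curve_is_vderive v Hv).
  assert (E := derivative_of_constant a b _ (-1) v _
    (fun r Hr => proj1 (proj2 Hg r Hr)) Hv (is_derive_mink _ _ _ _ _ Hd Hd)).
  rewrite (mink_comm (vDerive g v)) in E. lra.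
Qed.

Lemma mink_g_g'' (v : R) :
  in_itv a b v -> mink (g v) (vDerive (vDerive g) v) = -1.
Proof.
  intros Hv.
  assert (E := derivative_of_constant a b _ 0 v _ mink_g_g' Hv
    (is_derive_mink _ _ _ _ _ (unit_curve_is_vderive v Hv)
       (unit_curve_is_vderive2 v Hv))).
  rewrite (proj2 (proj2 Hg v Hv)) in E. lra.
Qed.

Lemma mink_g'_g'' (v : R) :
  in_itv a b v -> mink (vDerive g v) (vDerive (vDerive g) v) = 0.
Proof.
  intros Hv. assert (Hd := unit_curve_is_vderive2 v Hv).
  assert (E := derivative_of_constant a b _ 1 v _
    (fun r Hr => proj2 (proj2 Hg r Hr)) Hv (is_derive_mink _ _ _ _ _ Hd Hd)).
  rewrite (mink_comm (vDerive (vDerive g) v)) in E. lra.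
Qed.

Lemma mink_conormal (v : R) :
  in_itv a b v -> mink (conormal g v) (conormal g v) = 1.
Proof.
  intros Hv. unfold conormal. destruct (proj2 Hg v Hv) as [H1 H2].
  red in H1. rewrite mink_cross_cross, H1, H2, mink_g_g' by easy. ring.
Qed.

Lemma smooth_equidistant (c s : R) : smooth_on a b (equidistant c s g).
Proof.
  destruct Hg as [Hs _].
  apply smooth_on_add; apply smooth_on_scal; [|apply smooth_on_cross];
    auto using smooth_on_vDerive.
Qed.

Lemma mink_equidistant (c s v : R) :
  in_itv a b v ->
  mink (equidistant c s g v) (equidistant c s g v) = s ^ 2 - c ^ 2.
Proof.
  intros Hv. unfold equidistant.
  rewrite !mink_add_l, !mink_add_r, !mink_scal_l, !mink_scal_r.
  rewrite (mink_comm (conormal g v) (g v)), mink_conormal by easy.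
  unfold conormal. rewrite mink_cross_l.
  destruct (proj2 Hg v Hv) as [H1 _]. red in H1. rewrite H1. ring.
Qed.

(** The [g' x g'] half of [(g x g')'] vanishes and the other half is
    [g x g'' = - k g'], so the conormal turns along [g'] only. *)
Lemma is_vderive_equidistant (c s v : R) :
  in_itv a b v ->
  is_vderive (equidistant c s g) v
    (vscal (c - s * geodesic_curvature g v) (vDerive g v)).
Proof.
  intros Hv. destruct (proj2 Hg v Hv) as [H1 H2].
  assert (Hn := is_vderive_cross _ _ _ _ _ (unit_curve_is_vderive v Hv)
                  (unit_curve_is_vderive2 v Hv)).
  rewrite cross_self, (cross_frame (g v) (vDerive g v)) in Hn
    by auto using mink_g_g', mink_g_g'', mink_g'_g''.
  fold (conormal g v) in Hn. fold (geodesic_curvature g v) in Hn.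
  replace (vscal (c - s * geodesic_curvature g v) (vDerive g v)) with
    (vadd (vscal c (vDerive g v))
      (vscal s (vadd vzero (vscal (- geodesic_curvature g v) (vDerive g v)))))
    by (generalize (vDerive g v); intros; vec_ring).
  apply is_vderive_add; apply is_vderive_scal; auto using unit_curve_is_vderive.
Qed.

(** The tangent and the normal of a primitive of [equidistant c s g] lie along
    the two factors, so this computes the binormal. *)
Lemma cross_equidistant_g' (c s v : R) :
  in_itv a b v ->
  cross (equidistant c s g v) (vDerive g v) = equidistant s c g v.
Proof.
  intros Hv. destruct (proj2 Hg v Hv) as [_ H2].
  replace (cross (equidistant c s g v) (vDerive g v)) with
    (vadd (vscal c (conormal g v)) (vscal s (cross (conormal g v) (vDerive g v)))).
  2:{ unfold equidistant. fold (conormal g v). unfold conormal at 1.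
      generalize (conormal g v). intros. vec_ring. }
  unfold conormal at 2. rewrite cross_cross_l, H2, mink_g_g' by easy.
  unfold equidistant. generalize (conormal g v) (vDerive g v). intros. vec_ring.
Qed.

Lemma mink_g''_equidistant (c s v : R) :
  in_itv a b v ->
  mink (vDerive (vDerive g) v) (equidistant c s g v) =
  s * geodesic_curvature g v - c.
Proof.
  intros Hv. unfold equidistant.
  rewrite mink_add_r, !mink_scal_r, (mink_comm _ (g v)), mink_g_g'' by easy.
  fold (geodesic_curvature g v). ring.
Qed.

Lemma continuous_geodesic_curvature (v : R) :
  in_itv a b v -> continuous (geodesic_curvature g) v.
Proof.
  intros Hv. apply @ex_derive_continuous. eexists.
  assert (Hg' := smooth_on_vDerive a b g (proj1 Hg)).
  apply is_derive_mink; apply (smooth_on_is_vderive a b); auto.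
  - now apply smooth_on_vDerive.
  - apply smooth_on_cross; auto. apply Hg.
Qed.

(** * Curves whose velocity is equidistant from a curve *)

(** In arc length [t = |m| v] the curve is [h t = f (t / |m|)].  With [e] the
    sign of [c - s k] and [m / |m|] the sign of [m], the frame at [t] is
    [T = (m / |m|) p], [N = e (m / |m|) g'], [B = e (s g + c n)]. *)
Lemma bertrand_of_velocity (c s m : R) (f : R -> vec) :
  c ^ 2 - s ^ 2 = 1 -> s <> 0 -> m <> 0 ->
  (forall v, in_itv a b v -> c - s * geodesic_curvature g v <> 0) ->
  (forall v, in_itv a b v -> is_vderive f v (vscal m (equidistant c s g v))) ->
  timelike_bertrand a b f.
Proof.
  intros Hcs Hs Hm Hq Hf.
  destruct (nonvanishing_constant_sign a b
              (fun v => c - s * geodesic_curvature g v)) as [e [He Hsign]]; auto.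
  { intros v Hv. apply @continuous_minus; [apply continuous_const|].
    apply (continuous_scal_r s (geodesic_curvature g)).
    now apply continuous_geodesic_curvature. }
  assert (Hf' : forall v, in_itv a b v ->
            vDerive f v = vscal m (equidistant c s g v))
    by (intros v Hv; now apply is_vderive_unique, Hf).
  assert (Hfs : smooth_on a b f).
  { apply smooth_on_primitive with (1 := Hf). apply smooth_on_scal.
    apply smooth_equidistant. }
  assert (Hm2 : 0 < m * m) by (destruct (Rtotal_order m 0) as [|[|]]; nra).
  assert (Hp1 : forall v, in_itv a b v -> pnorm (equidistant c s g v) = 1).
  { intros v Hv. apply pnorm_1. rewrite mink_equidistant by easy.
    rewrite Rabs_left; lra. }
  split.
  { apply timelike_regular; auto. intros v Hv. unfold timelike.
    rewrite Hf', mink_scal_l, mink_scal_r, mink_equidistant by easy. nra. }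
  set (r := mkposreal (Rabs m) (Rabs_pos_lt m Hm)).
  assert (Hr : 0 < r) by apply cond_pos.
  (* [d] is the sign of [m] *)
  set (d := / r * m).
  assert (Hrr : r * r = m * m) by (simpl; rewrite <- Rabs_mult; apply Rabs_pos_eq; lra).
  assert (Hd2 : d * d = 1).
  { unfold d. replace (/ r * m * (/ r * m)) with (m * m / (r * r)) by (field; lra).
    rewrite Hrr. field. exact Hm. }
  assert (Habs : forall y, y * y = 1 -> Rabs y = 1).
  { intros y Hy. assert (H0 := Rabs_pos y).
    assert (H1 : Rabs y * Rabs y = 1)
      by (rewrite <- Rabs_mult, Hy; apply Rabs_R1). nra. }
  set (a' := Rbar_mult_pos a r). set (b' := Rbar_mult_pos b r).
  assert (Hitv : forall t, in_itv a' b' t -> in_itv a b (/ r * t)).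
  { intros t Ht. apply in_itv_scal with r.
    replace (/ r * t * r) with t by (field; lra). exact Ht. }
  set (h := fun t => f (/ r * t)).
  assert (HT : forall t, in_itv a' b' t ->
            vDerive h t = vscal d (equidistant c s g (/ r * t))).
  { intros t Ht. apply is_vderive_unique.
    replace (vscal d (equidistant c s g (/ r * t))) with
      (vscal (/ r) (vscal m (equidistant c s g (/ r * t))))
      by (unfold d; generalize (equidistant c s g (/ r * t)); intros; vec_ring).
    apply (is_vderive_rescale (/ r) f). auto. }
  assert (HT' : forall t, in_itv a' b' t -> vDerive (vDerive h) t =
            vscal (d * / r * (c - s * geodesic_curvature g (/ r * t)))
                  (vDerive g (/ r * t))).
  { intros t Ht. apply is_vderive_unique.
    apply (is_vderive_ext_itv a' b'
             (fun t => vscal d (equidistant c s g (/ r * t)))); auto.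
    { intros; symmetry; auto. }
    replace (vscal (d * / r * (c - s * geodesic_curvature g (/ r * t)))
                   (vDerive g (/ r * t))) with
      (vscal d (vscal (/ r) (vscal (c - s * geodesic_curvature g (/ r * t))
                                   (vDerive g (/ r * t)))))
      by (generalize (vDerive g (/ r * t)); intros; vec_ring).
    apply is_vderive_scal. apply (is_vderive_rescale (/ r)).
    now apply is_vderive_equidistant; auto. }
  assert (Hkappa : forall t, in_itv a' b' t -> pnorm (vDerive (vDerive h) t) =
            / r * (e * (c - s * geodesic_curvature g (/ r * t)))).
  { intros t Ht. rewrite HT', pnorm_scal by easy.
    destruct (proj2 Hg _ (Hitv t Ht)) as [_ H2].
    rewrite pnorm_1 by (rewrite H2; apply Rabs_R1).
    rewrite !Rabs_mult, (Habs d Hd2), Rabs_inv, (Rabs_pos_eq r) by lra.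
    assert (Hq1 := Hsign _ (Hitv t Ht)).
    rewrite <- (Rabs_pos_eq _ (Rlt_le _ _ Hq1)), Rabs_mult, (Habs e He). ring. }
  assert (HN : forall t, in_itv a' b' t ->
            fN h t = vscal (e * d) (vDerive g (/ r * t))).
  { intros t Ht. unfold fN. rewrite Hkappa, HT' by easy.
    assert (Hq1 := Hq _ (Hitv t Ht)).
    set (q := c - s * geodesic_curvature g (/ r * t)) in *.
    assert (He0 : e <> 0) by nra.
    replace (e * d) with (/ (/ r * (e * q)) * (d * / r * q)).
    { generalize (vDerive g (/ r * t)); intros; vec_ring. }
    transitivity (/ e * d); [field; repeat split; lra|].
    f_equal. apply Rmult_eq_reg_l with e; auto. rewrite He. field; auto. }
  assert (HB : forall t, in_itv a' b' t ->
            fB h t = vscal e (equidistant s c g (/ r * t))).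
  { intros t Ht. unfold fB, fT. rewrite HT, HN by easy.
    rewrite <- (cross_equidistant_g' c s) by auto.
    rewrite <- (Rmult_1_r e) at 2. rewrite <- Hd2.
    generalize (equidistant c s g (/ r * t)) (vDerive g (/ r * t)).
    intros; vec_ring. }
  assert (HN' : forall t, in_itv a' b' t -> vDerive (fN h) t =
            vscal (e * d * / r) (vDerive (vDerive g) (/ r * t))).
  { intros t Ht. apply is_vderive_unique.
    apply (is_vderive_ext_itv a' b' (fun t => vscal (e * d) (vDerive g (/ r * t))));
      auto.
    { intros; symmetry; auto. }
    replace (vscal (e * d * / r) (vDerive (vDerive g) (/ r * t))) with
      (vscal (e * d) (vscal (/ r) (vDerive (vDerive g) (/ r * t))))
      by (generalize (vDerive (vDerive g) (/ r * t)); intros; vec_ring).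
    apply is_vderive_scal. apply (is_vderive_rescale (/ r)).
    apply unit_curve_is_vderive2. auto. }
  assert (Htau : forall t, in_itv a' b' t -> torsion h t =
            d * / r * (c * geodesic_curvature g (/ r * t) - s)).
  { intros t Ht. unfold torsion. rewrite HN', HB, mink_scal_l, mink_scal_r by easy.
    rewrite mink_g''_equidistant by auto.
    transitivity (e * e * (d * / r * (c * geodesic_curvature g (/ r * t) - s)));
      [ring|rewrite He; ring]. }
  exists a', b', h. split; [|split; [|split; [|split]]].
  - exists (fun t => t * r). split.
    + intros t Ht. split; [|split].
      * now apply in_itv_scal.
      * rewrite Hf', pnorm_scal, Hp1 by easy.
        apply (is_derive_ext (fun t => r * t)); [intros; apply Rmult_comm|].
        apply (is_derive_scal (fun t => t) t r 1 (is_derive_id t)).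
      * unfold h. f_equal. field. lra.
    + intros t Ht. exists (/ r * t). split; [auto|field; lra].
  - apply timelike_regular; [exact (smooth_on_rescale a b r f Hfs)|].
    intros t Ht. unfold timelike.
    rewrite HT, mink_scal_l, mink_scal_r, mink_equidistant by auto. nra.
  - intros t Ht. rewrite HT, pnorm_scal, Hp1, (Habs d Hd2) by auto. ring.
  - intros t Ht. unfold curvature, fT. rewrite Hkappa by easy.
    apply Rmult_lt_0_compat; [now apply Rinv_0_lt_compat|]. auto.
  - assert (Hc : c <> 0) by (intros ->; nra).
    assert (He0 : e <> 0) by nra.
    (* [A] and [B] come from comparing the coefficients of [1] and [k] in
       [A e (c - s k) / |m| + B (c k - s) / m = 1] *)
    exists (e * r * c), (m * s). split; [|split].
    + repeat apply Rmult_integral_contrapositive_currified; auto. lra.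
    + now apply Rmult_integral_contrapositive_currified.
    + intros t Ht. unfold curvature, fT. rewrite Hkappa, Htau by easy.
      set (k := geodesic_curvature g (/ r * t)).
      transitivity ((e * e) * c * (c - s * k) + (d * d) * s * (c * k - s)).
      * unfold d. field. lra.
      * rewrite He, Hd2. lra.
Qed.

End UnitCurve.

(** * The v-parameter curves of the surface *)

Lemma spacelike_unit_speed (a b : Rbar) (g : R -> vec) (v : R) :
  spacelike_curve a b g -> unit_speed a b g -> in_itv a b v ->
  mink (vDerive g v) (vDerive g v) = 1.
Proof.
  intros [[_ Hreg] Hsp] Hu Hv. specialize (Hu v Hv).
  destruct (Hsp v Hv) as [H|H]; [|now elim (Hreg v Hv)].
  unfold pnorm in Hu. rewrite Rabs_pos_eq in Hu by lra.
  rewrite <- (sqrt_def (mink _ _)) by lra. rewrite Hu. ring.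
Qed.

Lemma cosh2_sinh2 (t : R) : cosh t ^ 2 - sinh t ^ 2 = 1.
Proof.
  unfold cosh, sinh.
  assert (H : exp t * exp (- t) = 1) by (rewrite exp_Ropp; field; apply Rgt_not_eq, exp_pos).
  lra.
Qed.

Lemma sinh_neq_0 (t : R) : t <> 0 -> sinh t <> 0.
Proof.
  intros H E. apply H. unfold sinh in E.
  assert (E' : exp t = exp (- t)) by lra. apply exp_inv in E'. lra.
Qed.

Lemma cosh_neq_0 (t : R) : cosh t <> 0.
Proof.
  unfold cosh. assert (H1 := exp_pos t). assert (H2 := exp_pos (- t)). lra.
Qed.

Lemma xi2_neq_0 (theta u : R) :
  theta <> 0 -> 0 < u -> u <> 1 -> xi2 theta u <> 0.
Proof.
  intros Ht Hu Hu1. unfold xi2, coth, Rdiv.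
  apply Rmult_integral_contrapositive_currified;
    [apply Rmult_integral_contrapositive_currified|].
  - apply cosh_neq_0.
  - now apply Rinv_neq_0_compat, sinh_neq_0.
  - rewrite <- ln_1. intros E. apply Hu1. apply ln_inv; auto. lra.
Qed.

Theorem theorem4 (a b : Rbar) (Ha : Rbar_lt a 0) (Hb : Rbar_lt 0 b)
    (g : R -> vec)
    (Hg_spacelike : spacelike_curve a b g)
    (Hg_unit : unit_speed a b g)
    (Hg_H2 : forall v, in_itv a b v -> in_H2 (g v))
    (theta : R) (Htheta : theta <> 0)
    (D : R * R -> Prop) (HD_open : open D)
    (HD : forall u v, D (u, v) -> 0 < u /\ in_itv a b v)
    (x : R -> R -> vec)
    (Hx : forall u v, D (u, v) ->
       x u v =
       vscal (u * sinh theta)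
         (vadd (vscal (cosh (xi2 theta u)) (g v))
               (vscal (sinh (xi2 theta u)) (cross (g v) (vDerive g v)))))
    (Hx_spacelike : spacelike_surface D x)
    (Hx_cone : in_timelike_cone D x)
    (Hx_slope : constant_slope D x)
    (u0 : R) (Hu0 : forall v, in_itv a b v -> D (u0, v))
    (Hu0_1 : u0 <> 1) :
  timelike_bertrand a b (fun v => vRInt (fun t => x u0 t) 0 v).
Proof.
  assert (Hg : unit_curve_H2 a b g).
  { split; [apply Hg_spacelike|]. intros v Hv. split; auto.
    now apply spacelike_unit_speed with a b. }
  assert (H0 : in_itv a b 0) by (split; assumption).
  destruct (HD u0 0 (Hu0 0 H0)) as [Hu_pos _].
  set (c := cosh (xi2 theta u0)). set (s := sinh (xi2 theta u0)).
  set (m := u0 * sinh theta).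
  assert (Hm : m <> 0).
  { apply Rmult_integral_contrapositive_currified; [lra|now apply sinh_neq_0]. }
  assert (Hxeq : forall v, in_itv a b v ->
            vscal m (equidistant c s g v) = x u0 v).
  { intros v Hv. symmetry. now apply Hx, Hu0. }
  assert (Hxs : smooth_on a b (fun t => x u0 t)).
  { assert (Hp := smooth_on_scal a b m _ (smooth_equidistant a b g Hg c s)).
    exact (smooth_on_ext a b _ _ Hxeq Hp). }
  apply (bertrand_of_velocity a b g Hg c s m); auto.
  - apply cosh2_sinh2.
  - apply sinh_neq_0. now apply xi2_neq_0.
  - intros v Hv Hq.
    (* the [v]-velocity of the surface would vanish, against immersivity *)
    assert (Hdv : d_v x u0 v = vzero).
    { apply is_vderive_unique.
      apply (is_vderive_ext_itv a b (fun v => vscal m (equidistant c s g v))); auto.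
      replace vzero with
        (vscal m (vscal (c - s * geodesic_curvature g v) (vDerive g v)))
        by (rewrite Hq; generalize (vDerive g v); intros; vec_ring).
      apply is_vderive_scal. now apply is_vderive_equidistant with a b. }
    destruct (proj1 Hx_spacelike u0 v (Hu0 v Hv) 0 1) as [_ E]; [|lra].
    rewrite Hdv. generalize (d_u x u0 v). intros. vec_ring.
  - intros v Hv. rewrite Hxeq by easy.
    now apply (is_vderive_vRInt a b (fun t => x u0 t) 0).
Qed.
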